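(* Let $q\in\mathbb{C}$, let $\lambda/\mu$ be a skew shape, and set $n=|\lambda|-|\mu|$. Then the $q$-deformed generating function of the labelled poset $P_{\lambda/\mu}=([n],<_{\lambda/\mu})$ (with all weights equal to $1$) is the Hall-Littlewood $S$-symmetric function with parameter $t=-q$: $$S_{\lambda/\mu}(X;-q)=\Gamma^{(q)}([n],<_{\lambda/\mu}).$$
   Context: Notation. $X=\{x_1,x_2,x_3,\dots\}$ is a set of indeterminates, $\mathbb{P}=\{1,2,3,\dots\}$, $[n]=\{1,\dots,n\}$, and $\mathbb{P}^{\pm}$ is the set of all positive and negative integers, totally ordered by $-1<1<-2<2<-3<3<\cdots$; $-\mathbb{P}=\{-n: n\in\mathbb{P}\}\subseteq\mathbb{P}^\pm$. In expressions $[f(i)<0]$ below, ''$<0$'' means that $f(i)$ is a negative integer, i.e. $f(i)\in-\mathbb{P}$; the bracket is $1$ if this holds and $0$ otherwise. Hall-Littlewood $S$-functions. For $t\in\mathbb{C}$ the symmetric functions $q_n(X;t)$ are defined by $\sum_{n\ge 0}q_n(X;t)u^n=\prod_i\frac{1-x_itu}{1-x_iu}$, so $q_0=1$, and $q_n(X;t)=0$ for $n<0$. A skew shape $\lambda/\mu$ is given by partitions $\lambda=(\lambda_1,\dots,\lambda_{\ell(\lambda)})$ and $\mu$ (parts in weakly decreasing order) with $\ell(\mu)\le\ell(\lambda)$ and $\mu_i\le\lambda_i$ for all $i\le \ell(\mu)$ (put $\mu_i=0$ for $i>\ell(\mu)$); $|\lambda|=\sum_i\lambda_i$. Its diagram has,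 in row $i$ from the top, the boxes in columns $\mu_i+1,\dots,\lambda_i$. Set $$S_{\lambda/\mu}(X;t)=\det\left(q_{\lambda_i-\mu_j-i+j}(X;t)\right)_{1\le i,j\le \ell(\lambda)}.$$ The poset $P_{\lambda/\mu}$. Number the $n=|\lambda|-|\mu|$ boxes of the diagram of $\lambda/\mu$ by $1,2,\dots,n$ from left to right within each row and going through the rows from bottom to top (so the bottom row receives the smallest numbers). Define the partial order $<_{\lambda/\mu}$ on $[n]$ by: $i<_{\lambda/\mu}j$ if and only if the box numbered $i$ lies (weakly) northwest of the box numbered $j$ and $i\neq j$ (i.e. its row is weakly above and its column weakly to the left). Enriched $P$-partitions. For a labelled poset $P=([n],<_P)$ (an arbitrary partial order on $[n]$), an enriched $P$-partition is a map $f:[n]\to\mathbb{P}^\pm$ such that: (i) if $i<_Pj$ and $i<j$, then $f(i)<f(j)$ or $f(i)=f(j)\in\mathbb{P}$; (ii) if $i<_Pj$ and $i>j$, then $f(i)<f(j)$ or $f(i)=f(j)\in-\mathbb{P}$. Let $\mathcal{L}_{\mathbb{P}^\pm}(P)$ be the set of these maps. For $q\in\mathbb{C}$, the $q$-deformed generating function (with all weights $1$) is $$\Gamma^{(q)}([n],<_P)=\sum_{f\in\mathcal{L}_{\mathbb{P}^\pm}(P)}\ \prod_{1\le i\le n}q^{[f(i)<0]}x_{|f(i)|}\in\mathbb{C}[[X]].$$ *)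

(* Defs.v *)
From HB Require Import structures.
From mathcomp Require Import all_boot all_order all_algebra finmap.
From mathcomp Require Import complex monalg.
From mathcomp Require Import mathcomp_extra boolp classical_sets cardinality
  functions fsbigop reals.

Set Implicit Arguments.
Unset Strict Implicit.
Unset Printing Implicit Defensive.

Import Order.TTheory GRing.Theory Num.Theory.

Local Open Scope ring_scope.

(* Formal power series over K in the (possibly infinitely many) commuting
   indeterminates indexed by I: arbitrary families of coefficients indexed by
   the monomials (finitely supported exponent vectors).  The sum defining the
   Cauchy product is finite by [finite_factors]. *)
Record fps (I : choiceType) (K : Type) :=
  Fps { fcoef :> {cmonom I} -> K }.

Definition factors (I : choiceType) (m : {cmonom I}) :
    set ({cmonom I} * {cmonom I}) := [set p | mmul p.1 p.2 = m]%classic.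

(* Locked, since unfolding monomials makes unification diverge. *)
HB.lock Definition fps_one (I : choiceType) (K : comNzRingType) : fps I K :=
  Fps (fun m => (m == mone)%:R).

HB.lock Definition fps_mul (I : choiceType) (K : comNzRingType)
    (f g : fps I K) : fps I K :=
  Fps (fun m => \sum_(p \in factors m) f p.1 * g p.2).

HB.lock Definition fvar (I : choiceType) (K : comNzRingType) (i : I) :
    fps I K := Fps (fun m => (m == ucm i)%:R).

Section FpsRing.
Context (I : choiceType) (K : comNzRingType).
Implicit Types (f g h : fps I K) (m x y z : {cmonom I}).

HB.instance Definition _ := gen_eqMixin (fps I K).
HB.instance Definition _ := gen_choiceMixin (fps I K).

Lemma fpsP f g : (forall m, f m = g m) -> f = g.
Proof. by case: f g => f [g] /= fg; congr Fps; apply: funext. Qed.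

Definition fps_zero : fps I K := Fps (fun=> 0).
Definition fps_opp f : fps I K := Fps (fun m => - f m).
Definition fps_add f g : fps I K := Fps (fun m => f m + g m).

Lemma fps_addA : associative fps_add.
Proof. by move=> f g h; apply: fpsP => m /=; rewrite addrA. Qed.
Lemma fps_addC : commutative fps_add.
Proof. by move=> f g; apply: fpsP => m /=; rewrite addrC. Qed.
Lemma fps_add0 : left_id fps_zero fps_add.
Proof. by move=> f; apply: fpsP => m /=; rewrite add0r. Qed.
Lemma fps_addN : left_inverse fps_zero fps_opp fps_add.
Proof. by move=> f; apply: fpsP => m /=; rewrite addNr. Qed.

HB.instance Definition _ :=
  GRing.isZmodule.Build (fps I K) fps_addA fps_addC fps_add0 fps_addN.

Definition fps_scale (c : K) f : fps I K := Fps (fun m => c * f m).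

Lemma fcoefM f g m : fps_mul f g m = \sum_(p \in factors m) f p.1 * g p.2.
Proof. by rewrite fps_mul.unlock. Qed.
Lemma fcoef1 m : fps_one I K m = (m == mone)%:R.
Proof. by rewrite fps_one.unlock. Qed.
Lemma fcoefX i m : fvar K i m = (m == ucm i)%:R.
Proof. by rewrite fvar.unlock. Qed.

Lemma mmul_inj x : injective (mmul x).
Proof.
move=> y z /eqP/cmP e; apply/eqP/cmP => i.
by have := e i; rewrite !cmM => /addnI.
Qed.

Lemma finite_factors m : finite_set (factors m).
Proof.
pose D (g : {ffun finsupp m -> 'I_(mdeg m).+1}) : {cmonom I} :=
  mkcmonom [fsfun i : finsupp m => g i : nat | 0%N].
apply: (@sub_finite_set _ _ [set (D g, divcm m (D g)) | g in setT]%classic).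
  move=> [x y] /= xym.
  have le i : (x i <= m i)%N by rewrite -xym cmM leq_addr.
  have led i : (m i <= mdeg m)%N.
    case: (mdomP m i) => // im; rewrite mdegE (bigD1_seq i) //= leq_addr //.
  exists [ffun i => inord (x (val i))] => //.
  have -> : D [ffun i => inord (x (val i))] = x.
    apply/eqP/cmP => i; rewrite /D cmE /= fsfun_ffun.
    case: insubP => /= [u _ <-|im].
      by rewrite ffunE inordK // ltnS (leq_trans (le _)).
    by apply/esym/eqP; rewrite -leqn0 (leq_trans (le i)) // leqn0 cmE_eq0.
  congr pair; apply: (@mmul_inj x); rewrite xym; apply/eqP/cmP => i.
  by rewrite cmM divcmE subnKC.
by apply: finite_image; apply: finite_finset.
Qed.

Let divs m : seq {cmonom I} := undup [seq p.1 | p <- fset_set (factors m)].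

Let mem_divs x m : (exists y, mmul x y = m) -> x \in divs m.
Proof.
case=> y xy; rewrite mem_undup; apply/mapP; exists (x, y) => //.
by rewrite in_fset_set ?inE //; exact: finite_factors.
Qed.

Let divsP x m : x \in divs m -> exists y, mmul x y = m.
Proof.
rewrite mem_undup => /mapP[[x' y]] /=.
by rewrite in_fset_set ?inE /factors /= => [<- ->|]; [exists y|exact: finite_factors].
Qed.

Let divs_trans x m : x \in divs m -> {subset divs x <= divs m}.
Proof.
move=> /divsP[y <-] z /divsP[t <-]; apply: mem_divs.
by exists (mmul t y); rewrite mulmA.
Qed.

Let divs_id m : m \in divs m.
Proof. by apply: mem_divs; exists mone; rewrite mulm1. Qed.

Let fps_mulE f g r m : uniq r -> {subset divs m <= r} ->
  fps_mul f g m =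
  \sum_(x <- r) \sum_(y <- r) (if mmul x y == m then f x * g y else 0).
Proof.
move=> ur mr; rewrite fcoefM.
transitivity (\sum_(p <- [seq (x, y) | x <- r, y <- r])
  (if mmul p.1 p.2 == m then f p.1 * g p.2 else 0)); last first.
  by rewrite big_allpairs.
rewrite -[RHS]big_mkcond -[RHS]big_filter; apply: fsbig_fwiden.
- move=> [x y] /= xy; rewrite mem_filter /= xy eqxx /=.
  apply/allpairsP; exists (x, y); split => //; apply: mr; apply: mem_divs.
    by exists y.
  by exists x; rewrite mulmC.
- by rewrite filter_uniq // allpairs_uniq // => -[? ?] [].
- by move=> [x y] /= [+ xy]; rewrite mem_filter /= => /andP[/eqP].
Qed.

Lemma fps_mulC : commutative (@fps_mul I K).
Proof.
move=> f g; apply: fpsP => m.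
rewrite !(@fps_mulE _ _ (divs m)) ?undup_uniq // exchange_big /=.
by apply: eq_bigr => x _; apply: eq_bigr => y _; rewrite mulmC mulrC.
Qed.

Lemma fps_mul1 : left_id (fps_one I K) (@fps_mul I K).
Proof.
move=> f; apply: fpsP => m; rewrite fcoefM.
rewrite (fsbigD1 (mone, m)) /=; first last.
- by rewrite /factors /= mul1m.
- exact: finite_factors.
rewrite fcoef1 eqxx mul1r fsbig1 ?addr0 // => -[x y] /= [xy].
rewrite fcoef1.
case: eqP => [x1|]; last by rewrite mul0r.
by move: xy; rewrite /factors /= x1 mul1m => ->.
Qed.

Let big_if_eq (r : seq {cmonom I}) x m b (c : K) : uniq r ->
    (mmul x b == m -> b \in r) ->
  \sum_(a <- r) (if mmul x a == m then (if b == a then c else 0) else 0) =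
  (if mmul x b == m then c else 0).
Proof.
move=> ur; case: ifPn => [xb /(_ isT) br|xb _].
  rewrite (bigD1_seq b) //= xb eqxx big1 ?addr0 // => a ab.
  by rewrite [b == a]eq_sym (negbTE ab) if_same.
by rewrite big1 // => a _; case: ifP => // xa; case: eqP => // e;
  rewrite -e (negbTE xb) in xa.
Qed.

Let fps_mulA_l f g h m r : uniq r -> r =i divs m ->
  fps_mul f (fps_mul g h) m =
  \sum_(x <- r) \sum_(y <- r) \sum_(z <- r)
    (if mmul x (mmul y z) == m then f x * (g y * h z) else 0).
Proof.
move=> ur rm; rewrite (@fps_mulE _ _ r) //; last by move=> x; rewrite rm.
apply: eq_bigr => x _.
transitivity (\sum_(a <- r) \sum_(y <- r) \sum_(z <- r)
   (if mmul x a == m then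
     (if mmul y z == a then f x * (g y * h z) else 0) else 0)).
  apply: eq_big_seq => a ar.
  rewrite (@fps_mulE _ _ r) //; last first.
    by move=> y ya; rewrite rm; apply: (@divs_trans a); rewrite -?rm.
  case: ifP => _; last by rewrite big1 // => y _; rewrite big1.
  rewrite mulr_sumr; apply: eq_bigr => y _; rewrite mulr_sumr.
  by apply: eq_bigr => z _; case: ifP; rewrite ?mulr0.
rewrite exchange_big; apply: eq_bigr => y _.
rewrite exchange_big; apply: eq_bigr => z _.
apply: big_if_eq => // /eqP e; rewrite rm; apply: mem_divs.
by exists x; rewrite mulmC.
Qed.

Lemma fps_mulA : associative (@fps_mul I K).
Proof.
move=> f g h; apply: fpsP => m.
rewrite [in RHS]fps_mulC !(@fps_mulA_l _ _ _ m (divs m)) ?undup_uniq //.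
rewrite [RHS]exchange_big; apply: eq_bigr => x _ /=.
rewrite [RHS]exchange_big; apply: eq_bigr => y _ /=.
apply: eq_bigr => z _; rewrite mulmA [mmul z _]mulmC.
by rewrite mulrA [h z * _]mulrC.
Qed.

Lemma fps_mulDl : left_distributive (@fps_mul I K) fps_add.
Proof.
move=> f g h; apply: fpsP => m.
rewrite [RHS]/= !fcoefM -fsbig_split; last exact: finite_factors.
by apply: eq_fsbigr => p _; rewrite mulrDl.
Qed.

Lemma fps_one_neq0 : fps_one I K != 0.
Proof.
apply/eqP => /(congr1 (fun f : fps I K => f mone)); rewrite fcoef1 /= => /eqP.
by rewrite eqxx oner_eq0.
Qed.

HB.instance Definition _ := GRing.Zmodule_isComNzRing.Build (fps I K)
  fps_mulA fps_mulC fps_mul1 fps_mulDl fps_one_neq0.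

Lemma fps_scaleA a b f : fps_scale a (fps_scale b f) = fps_scale (a * b) f.
Proof. by apply: fpsP => m /=; rewrite mulrA. Qed.
Lemma fps_scale1 : left_id 1 fps_scale.
Proof. by move=> f; apply: fpsP => m /=; rewrite mul1r. Qed.
Lemma fps_scaleDr : right_distributive fps_scale +%R.
Proof. by move=> a f g; apply: fpsP => m /=; rewrite mulrDr. Qed.
Lemma fps_scaleDl f : {morph fps_scale^~ f : a b / a + b}.
Proof. by move=> a b; apply: fpsP => m /=; rewrite mulrDl. Qed.

HB.instance Definition _ := GRing.Zmodule_isLmodule.Build K (fps I K)
  fps_scaleA fps_scale1 fps_scaleDr fps_scaleDl.

Lemma fps_scaleAl a f g : a *: (f * g) = a *: f * g.
Proof.
apply: fpsP => m; rewrite [RHS]fcoefM /= fcoefM full_fsbig_distrr.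
  by apply: eq_fsbigr => p _; exact: mulrA.
by apply: finite_setIl; exact: finite_factors.
Qed.

HB.instance Definition _ := GRing.Lmodule_isLalgebra.Build K (fps I K)
  fps_scaleAl.
HB.instance Definition _ := GRing.Lalgebra_isComAlgebra.Build K (fps I K).

Definition fps_unit : pred (fps I K) := fun f => `[< exists g, g * f = 1 >].
Definition fps_inv f : fps I K := xget f [set g | g * f = 1]%classic.

Lemma fps_mulVf : {in fps_unit, left_inverse 1 fps_inv *%R}.
Proof. by move=> f /asboolP ex; exact: (xgetPex f ex). Qed.
Lemma fps_unitPl f g : g * f = 1 -> fps_unit f.
Proof. by move=> gf; apply/asboolP; exists g. Qed.
Lemma fps_inv_out : {in [predC fps_unit], fps_inv =1 id}.
Proof.
move=> f /asboolPn nex; rewrite /fps_inv xgetPN // => g gf.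
by apply: nex; exists g.
Qed.

HB.instance Definition _ := GRing.ComNzRing_hasMulInverse.Build (fps I K)
  fps_mulVf fps_unitPl fps_inv_out.

Lemma fcoefD f g m : (f + g) m = f m + g m. Proof. by []. Qed.
Lemma fcoefN f m : (- f) m = - f m. Proof. by []. Qed.
Lemma fcoefB f g m : (f - g) m = f m - g m. Proof. by []. Qed.
Lemma fcoefZ a f m : (a *: f) m = a * f m. Proof. by []. Qed.

Lemma fcoefMvar f i m :
  (f * fvar K i) m = if m i == 0%N then 0 else f (divcm m (ucm i)).
Proof.
rewrite fcoefM; case: ifPn => [/eqP mi|mi].
  apply: fsbig1 => -[x y] /= xy; rewrite fcoefX; case: eqP => [yi|]; last by rewrite mulr0.
  by move: mi; rewrite -xy cmM yi cmU eqxx addn1.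
have e : mmul (divcm m (ucm i)) (ucm i) = m.
  apply/eqP/cmP => j; rewrite cmM divcmE subnK // cmU.
  by case: eqP => // <-; rewrite lt0n.
rewrite (fsbigD1 (divcm m (ucm i), ucm i)) //=; last exact: finite_factors.
rewrite fcoefX eqxx mulr1 fsbig1 ?addr0 // => -[x y] /= [xy].
rewrite fcoefX.
case: eqP => [yi|]; last by rewrite mulr0.
case; congr pair => //; apply: (@mmul_inj (ucm i)).
by rewrite mulmC -yi xy yi mulmC.
Qed.

End FpsRing.

(* Coefficientwise limits: C[[X]] carries the product of the discrete
   topologies, so a sequence converges iff each coefficient is eventually
   constant; divergent coefficients get the junk value 0. *)
Definition fps_lim (I : choiceType) (K : nzRingType) (s : nat -> fps I K) :
    fps I K :=
  Fps (fun m => xget 0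
    [set c | exists N, forall k, (N <= k)%N -> s k m = c]%classic).

(* The sum of a family of series, meaningful when only finitely many members
   contribute to each coefficient. *)
Definition fps_sum (I : choiceType) (K : nzRingType) (T : choiceType)
    (A : set T) (F : T -> fps I K) : fps I K :=
  Fps (fun m => \sum_(x \in A) F x m).

Definition is_part (la : seq nat) : bool := sorted geq la && all (fun k => 0 < k)%N la.

Definition skew_shape (la mu : seq nat) : bool :=
  [&& is_part la, is_part mu, (size mu <= size la)%N
    & all (fun i => nth 0%N mu i <= nth 0%N la i)%N (iota 0 (size mu))].

Section HallLittlewood.
Context (K : comNzRingType).
Implicit Types (t : K) (n : nat) (la mu : seq nat).

(* The indeterminates x_1, x_2, ... are indexed from 0: [fvar K k] is x_(k+1).
   C[[X]][[u]] is [fps unit (fps nat K)], with u the only indeterminate. *)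
Local Notation x_ := (@fvar nat K).
Local Notation u := (@fvar unit (fps nat K) tt).

Definition upow n : {cmonom unit} := expcmn (ucm tt) n.

Definition HL_factor t (i : nat) : fps unit (fps nat K) :=
  (1 - (t *: x_ i) *: u) / (1 - x_ i *: u).

(* The generating function of the q_n(X;t): the infinite product of the
   factors above, computed coefficientwise; it converges by [HL_gen_cvg]. *)
Definition HL_gen t : fps unit (fps nat K) :=
  Fps (fun m => fps_lim (fun N => (\prod_(i < N) HL_factor t i) m)).

Definition HL_q t (n : int) : fps nat K :=
  match n with
  | Posz k => HL_gen t (upow k)
  | Negz _ => 0
  end.

Lemma one_sub_unit (a : fps nat K) : (1 - a *: u) \is a GRing.unit.
Proof.
pose geo : fps unit (fps nat K) := Fps (fun m => a ^+ m tt).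
apply: (@fps_unitPl _ _ _ geo); rewrite mulrBr mulr1 -scalerAr.
apply: fpsP => m; rewrite fcoefB fcoefZ fcoefMvar fcoef1 /=.
have -> : (m == mone) = (m tt == 0%N).
  apply/eqP/eqP => [->|m0]; first by rewrite cm1.
  by apply/eqP/cmP => -[]; rewrite m0 cm1.
have [->|m0] := eqVneq (m tt) 0%N; first by rewrite mulr0 subr0.
by rewrite divcmE cmU eqxx -exprS subn1 prednK ?lt0n // subrr.
Qed.

Let frac_split (R : comNzRingType) (A : comUnitAlgType R) (a b : R) (v : A) :
  1 - a *: v \is a GRing.unit ->
  (1 - b *: v) / (1 - a *: v) = 1 + ((a - b) *: v) / (1 - a *: v).
Proof.
move=> au; rewrite -[X in _ = X + _](divrr au) -mulrDl; congr (_ / _).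
by rewrite scalerBl addrA subrK.
Qed.

Lemma HL_gen_cvg t (m : {cmonom unit}) (k : {cmonom nat}) :
  exists N, forall M, (N <= M)%N ->
    HL_gen t m k = (\prod_(i < M) HL_factor t i) m k.
Proof.
pose N := (\max_(i <- finsupp k) i).+1.
suff cst M : (N <= M)%N -> (\prod_(i < M) HL_factor t i) m k =
    (\prod_(i < N) HL_factor t i) m k.
  exists N => M NM; rewrite cst //=; apply: xget_unique.
    by exists N => j /cst.
  move=> c [N' cN']; rewrite -(cst (maxn N N')) ?leq_maxl //.
  by rewrite cN' ?leq_maxr.
elim: M => [|M IH]; first by rewrite ltn0.
rewrite leq_eqVlt => /predU1P[-> //|NM]; rewrite -IH //.
have -> : \prod_(i < M.+1) HL_factor t i =
          (\prod_(i < M) HL_factor t i) * HL_factor t M.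
  by rewrite big_ord_recr.
pose G : fps unit (fps nat K) := ((1 - t)%:A *: u) / (1 - x_ M *: u).
have -> : HL_factor t M = 1 + x_ M *: G.
  rewrite /HL_factor (frac_split _ (one_sub_unit _)) /G scalerAl scalerA.
  by rewrite -[x_ M * _]scalerAr mulr1 [(1 - t) *: _]scalerBl scale1r.
rewrite mulrDr mulr1 -scalerAr !fcoefD fcoefZ mulrC fcoefMvar.
case: eqP => [_|/eqP]; first by rewrite addr0.
rewrite cmE_neq0 => Mk; suff : (M < N)%N by rewrite ltnNge -ltnS NM.
by rewrite ltnS; apply: (@leq_bigmax_seq _ _ xpredT id).
Qed.

Definition HL_S t la mu : fps nat K :=
  \det (\matrix_(i < size la, j < size la)
    HL_q t ((nth 0%N la i)%:Z - (nth 0%N mu j)%:Z - i%:Z + j%:Z)).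

End HallLittlewood.

(* Boxes are (row, column) pairs counted from 0, listed in the order of their
   labels: rows from bottom to top, left to right inside a row. *)
Definition skew_boxes (la mu : seq nat) : seq (nat * nat) :=
  flatten [seq [seq (i, c) | c <- iota (nth 0%N mu i)
                                       (nth 0%N la i - nth 0%N mu i)]
          | i <- rev (iota 0 (size la))].

Definition skew_size (la mu : seq nat) : nat := (sumn la - sumn mu)%N.

(* The label k + 1 is represented by the ordinal k. *)
Definition skew_box (la mu : seq nat) (i : 'I_(skew_size la mu)) : nat * nat :=
  nth (0%N, 0%N) (skew_boxes la mu) i.

Definition skew_lt (la mu : seq nat) : rel 'I_(skew_size la mu) :=
  fun i j => [&& i != j, ((skew_box i).1 <= (skew_box j).1)%N
                       & ((skew_box i).2 <= (skew_box j).2)%N].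

Lemma size_skew_boxes (la mu : seq nat) :
  skew_shape la mu -> size (skew_boxes la mu) = skew_size la mu.
Proof.
case/and4P=> _ _ smu /allP sub; rewrite size_flatten /shape -map_comp.
under eq_map do rewrite /= size_map size_iota.
rewrite map_rev sumn_rev /skew_size.
have E (s : seq nat) : (size s <= size la)%N ->
    sumn s = (\sum_(0 <= i < size la) nth 0%N s i)%N.
  move=> sl; rewrite sumnE (big_nth 0%N) (big_cat_nat _ sl) //=.
  rewrite [X in (_ + X)%N]big_nat_cond [X in (_ + X)%N]big1 ?addn0 // => i.
  by case/andP=> /andP[si _] _; rewrite nth_default.
rewrite (E la) // (E mu) // sumnE big_map -sumnB; last first.
  move=> i _; have [im|im] := ltnP i (size mu); last by rewrite nth_default.
  by apply: sub; rewrite mem_iota.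
by rewrite /index_iota subn0.
Qed.

Lemma uniq_skew_boxes (la mu : seq nat) : uniq (skew_boxes la mu).
Proof.
rewrite /skew_boxes; apply: allpairs_uniq_dep.
- by rewrite rev_uniq iota_uniq.
- by move=> i _; exact: iota_uniq.
- by move=> [i c] [j d] _ _ /= [-> ->].
Qed.

Lemma skew_lt_irr (la mu : seq nat) : irreflexive (@skew_lt la mu).
Proof. by move=> i; rewrite /skew_lt eqxx. Qed.

Lemma skew_lt_trans (la mu : seq nat) :
  skew_shape la mu -> transitive (@skew_lt la mu).
Proof.
move=> sh j i k /and3P[ij r1 c1] /and3P[jk r2 c2].
rewrite /skew_lt (leq_trans r1 r2) (leq_trans c1 c2) !andbT.
apply/eqP => ik; move/eqP: ij; apply; apply: val_inj; apply/eqP.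
rewrite -(nth_uniq (0%N, 0%N) _ _ (uniq_skew_boxes la mu))
  ?size_skew_boxes ?ltn_ord //.
rewrite -/(skew_box i) -/(skew_box j); move: r2 c2; rewrite -ik => r2 c2.
by rewrite -pair_eqE /pair_eq !eqn_leq r1 r2 c1 c2.
Qed.

(* The order -1 < 1 < -2 < 2 < ... on the nonzero integers. *)
Definition pm_lt (a b : int) : bool :=
  (`|a| < `|b|)%N || [&& `|a|%N == `|b|%N, a < 0 & 0 < b].

(* [P] is the strict order of a labelled poset. *)
Definition enriched (n : nat) (P : rel 'I_n) : set {ffun 'I_n -> int} :=
  [set f | [/\ forall i, f i != 0,
     forall i j, P i j -> (i < j)%N ->
       pm_lt (f i) (f j) \/ f i = f j /\ 0 < f i
   & forall i j, P i j -> (j < i)%N ->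
       pm_lt (f i) (f j) \/ f i = f j /\ f i < 0]]%classic.

Section Gamma.
Context (K : comNzRingType) (n : nat).
Implicit Types (q : K) (f : {ffun 'I_n -> int}).

Definition Gamma_term q f : fps nat K :=
  \prod_(i < n) (q ^+ (f i < 0)%R *: fvar K `|f i|%N.-1).

(* This sum is locally finite by [Gamma_finite]. *)
Definition Gamma (P : rel 'I_n) q : fps nat K :=
  fps_sum (enriched P) (Gamma_term q).

Lemma Gamma_finite (P : rel 'I_n) q (m : {cmonom nat}) :
  finite_set (enriched P `&` [set f | Gamma_term q f m != 0])%classic.
Proof.
pose N := (\max_(i <- finsupp m) i).+2.
pose D (g : {ffun 'I_n -> 'I_N * bool}) : {ffun 'I_n -> int} :=
  [ffun i => (-1) ^+ (g i).2 * ((g i).1 : nat)%:Z].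
apply: (@sub_finite_set _ _ [set D g | g in setT]%classic); last first.
  by apply: finite_image; apply: finite_finset.
move=> f [_ /= fm0].
have fN i : (`|f i| < N)%N.
  suff : `|f i|%N.-1 \in finsupp m.
    move=> /(@leq_bigmax_seq _ _ xpredT id) /(_ isT) /= le.
    by rewrite /N ltnS; case: `|f i|%N le.
  rewrite -cmE_neq0; apply: contraNneq fm0 => m0.
  rewrite /Gamma_term (bigD1 i) //= -scalerAl fcoefZ [fvar _ _ * _]mulrC.
  by rewrite fcoefMvar m0 eqxx mulr0.
exists [ffun i => (inord `|f i|%N, f i < 0)] => //.
apply/ffunP => i; rewrite !ffunE /= inordK //.
by rewrite abszE -numEsign.
Qed.

End Gamma.

(* Main.v *)
Require Import Defs.
From HB Require Import structures.
From mathcomp Require Import all_boot all_order all_algebra finmap.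
From mathcomp Require Import complex monalg.
From mathcomp Require Import boolp classical_sets fsbigop reals.
From mathcomp Require Import zify.

(* Both sides are computed by adding the letters -1 < 1 < -2 < 2 < ... one at
   a time.  Adding the letter -k multiplies the generating function of the
   entries of the determinant by 1 + q x_k u, adding k divides it by 1 - x_k u.
   In the first case, expanding the determinant row by row gives a sum over the
   nu obtained from lambda by shortening some rows by one box, and the terms
   where nu is not a partition have two equal rows (or a zero row), so that
   only vertical strips lambda/nu survive.  In the second case, subtracting
   from each row a multiple of the next one leaves in row i exactly the terms
   with lambda_(i+1) <= nu_i <= lambda_i: a sum over horizontal strips.
   The boxes filled with the largest letter of an enriched P-partition form the
   same strips, so both sides satisfy the same recursion.  Comparing a given
   coefficient only involves finitely many indeterminates. *)

Set Implicit Arguments.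
Unset Strict Implicit.
Unset Printing Implicit Defensive.

Import Order.TTheory GRing.Theory Num.Theory.

Local Open Scope ring_scope.

(** * Determinants *)

(** In the Leibniz formula the product of the row sums is distributed; [nu] records the summand
    chosen in each row. *)
Lemma det_multilinear (A : comNzRingType) (l : nat) (J : finType)
    (s : 'I_l -> J -> A) (F : 'I_l -> J -> 'I_l -> A) :
  \det (\matrix_(i, j) \sum_c s i c * F i c j) =
  \sum_(nu : {ffun 'I_l -> J})
     (\prod_i s i (nu i)) * \det (\matrix_(i, j) F i (nu i) j).
Proof.
rewrite /determinant.
under eq_bigr => p _ do under eq_bigr => i _ do rewrite mxE.
under eq_bigr => p _ do rewrite bigA_distr_bigA /= mulr_sumr.
rewrite exchange_big /=; apply: eq_bigr => nu _.
rewrite mulr_sumr; apply: eq_bigr => p _.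
rewrite big_split /= mulrCA; congr (_ * (_ * _)).
by apply: eq_bigr => i _; rewrite mxE.
Qed.

Lemma det_row_eq0 (A : comNzRingType) (l : nat) (B : 'M[A]_l) (i : 'I_l) :
  (forall j, B i j = 0) -> \det B = 0.
Proof. by move=> Bi; rewrite (expand_det_row _ i) big1 // => j _; rewrite Bi mul0r. Qed.

Lemma det_col_eq0 (A : comNzRingType) (l : nat) (B : 'M[A]_l) (j : 'I_l) :
  (forall i, B i j = 0) -> \det B = 0.
Proof.
by move=> Bj; rewrite -det_tr; apply: (@det_row_eq0 _ _ _ j) => i; rewrite mxE Bj.
Qed.

Definition weakly_dec (l M : nat) (a : {ffun 'I_l -> 'I_M}) : bool :=
  [forall i : 'I_l, forall j : 'I_l, (i <= j)%N ==> (a j <= a i)%N].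

Lemma weakly_decP (l M : nat) (a : {ffun 'I_l -> 'I_M}) :
  reflect (forall i j : 'I_l, (i <= j)%N -> (a j <= a i)%N) (weakly_dec a).
Proof.
apply: (iffP forallP) => [h i j ij|h i]; last by apply/forallP => j; apply/implyP/h.
by have /forallP/(_ j)/implyP := h i; apply.
Qed.

Definition vert_strip (l M : nat) (nu a : {ffun 'I_l -> 'I_M}) : bool :=
  weakly_dec nu && [forall i, (nu i <= a i <= (nu i).+1)%N].

Definition horiz_strip (l M : nat) (nu a : {ffun 'I_l -> 'I_M}) : bool :=
  [forall i, (nu i <= a i)%N] &&
  [forall i : 'I_l, forall j : 'I_l, (i < j)%N ==> (a j <= nu i)%N].

(** * Jacobi-Trudi determinants and removal of strips *)

Section JacobiTrudi.
Context (A : comNzRingType) (l M : nat) (mu : nat -> nat).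
Hypothesis mu_dec : forall i j, (i <= j)%N -> (mu j <= mu i)%N.
Implicit Types (h : int -> A) (a nu : {ffun 'I_l -> 'I_M}).

Definition JT h a : A :=
  \det (\matrix_(i < l, j < l)
    h ((a i)%:Z - (mu j)%:Z - i%:Z + j%:Z)).

(** At the first row [i] where [a] and [mu] differ, [a i < mu i] makes column [i] vanish and
    [a i > mu i] makes row [i] vanish, because no index in it is 0. Without such a row the matrix is
    the identity. *)
Lemma JT_delta a : weakly_dec a ->
  JT (fun n => (n == 0)%:R) a = [forall i, a i == mu i :> nat]%:R.
Proof.
move=> /weakly_decP adec; rewrite /JT.
have [/forallP aE|/forallPn[i0 ai0]] := boolP [forall i : 'I_l, a i == mu i :> nat].
  rewrite -[RHS](det1 A l) /=; congr determinant.
  apply/matrixP => i j; rewrite !mxE.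
  congr (_%:R); rewrite (eqP (aE i)) -val_eqE /=.
  case: (ltngtP i j) => ij.
  - by have := mu_dec (ltnW ij); lia.
  - by have := mu_dec (ltnW ij); lia.
  by rewrite ij; lia.
have [i ai imin] := @arg_minnP _ i0 (fun i => a i != mu i :> nat) val ai0.
have eqlt (j : 'I_l) : (j < i)%N -> a j = mu j :> nat.
  move=> ji; apply/eqP; apply: contraTT ji => aj.
  by rewrite -leqNgt; apply: imin.
move: ai; rewrite neq_ltn => /orP[lt|gt].
  apply: (@det_col_eq0 _ _ _ i) => j; rewrite mxE.
  suff /negbTE -> : (a j)%:Z - (mu i)%:Z - j%:Z + i%:Z != 0 by [].
  have [ji|ij] := ltnP j i.
    by have := mu_dec (ltnW ji); rewrite (eqlt j ji); lia.
  by have := adec i j ij; lia.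
apply: (@det_row_eq0 _ _ _ i) => j; rewrite mxE.
suff /negbTE -> : (a i)%:Z - (mu j)%:Z - i%:Z + j%:Z != 0 by [].
have [ji|ij] := ltnP j i.
  by have := adec j i (ltnW ji); rewrite (eqlt j ji); lia.
by have := mu_dec ij; lia.
Qed.

(* Parts beyond the last row are 0. *)
Definition part_at a (i : nat) : nat := oapp (fun j => a j : nat) 0%N (insub i).

Lemma part_atE a (i : 'I_l) : part_at a i = a i.
Proof. by rewrite /part_at valK. Qed.

Lemma part_at_ge a (i : nat) : (l <= i)%N -> part_at a i = 0%N.
Proof. by move=> li; rewrite /part_at insubN // -leqNgt. Qed.

Lemma part_at_dec a (i j : nat) :
  weakly_dec a -> (i <= j)%N -> (part_at a j <= part_at a i)%N.
Proof.
move=> /weakly_decP adec ij; have [lj|jl] := leqP l j; first by rewrite part_at_ge.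
have il := leq_ltn_trans ij jl.
by rewrite (part_atE a (Ordinal jl)) (part_atE a (Ordinal il)) adec.
Qed.

(* Some row between i and j has the same entries as the next one, or is the last
   row and vanishes. *)
Lemma JT_vert_cancel h a (e : {ffun 'I_l -> bool}) (i j : nat) : weakly_dec a ->
    (forall n, n < 0 -> h n = 0) ->
    (i < j <= l)%N -> part_at a i = part_at a j ->
    oapp e false (insub i) -> ~~ oapp e false (insub j) ->
  \det (\matrix_(i, j) h ((a i)%:Z - (e i)%:Z - (mu j)%:Z - i%:Z + j%:Z)) = 0.
Proof.
move=> adec h0; move En: (j - i)%N => n.
elim: n i En => [|n IH] i En /andP[ij jl] aij ei ej; first by lia.
have il := leq_trans ij jl.
have ai1 : part_at a i = part_at a i.+1.
  by have := part_at_dec adec (leqnSn i); have := part_at_dec adec ij; lia.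
(* If row [i.+1] is shortened too, the induction moves down to it. If not, the shortened row [i] has
   the same indices as row [i.+1]. *)
have [ei1|ei1] := boolP (oapp e false (insub i.+1)).
  have ij1 : (i.+1 < j)%N.
    by rewrite ltn_neqAle ij andbT; apply: contraTneq ei1 => ->.
  by apply: (IH i.+1) => //; lia.
move: ei ei1 ai1; rewrite (part_atE a (Ordinal il)) insubT /= => ei.
have [i1l|li1] := ltnP i.+1 l.
  rewrite (part_atE a (Ordinal i1l)) insubT /= => ei1 ai1.
  apply: (@determinant_alternate _ _ _ (Ordinal il) (Ordinal i1l)).
    by rewrite -val_eqE /=; lia.
  move=> c; rewrite !mxE ei (negbTE ei1) ai1 /=; congr (h _); lia.
rewrite part_at_ge // => _ ai.
apply: (@det_row_eq0 _ _ _ (Ordinal il)) => c; rewrite mxE; apply: h0.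
rewrite ei ai /=; have := ltn_ord c; lia.
Qed.

(** Each row is the row of [a] plus [x] times the same row with one box less. Expanding gives a sum
    over the sets [e] of shortened rows, where [JT_vert_cancel] kills the terms in which [a - e] is
    not a partition. *)
Lemma JT_vert (x : A) h h' a : weakly_dec a ->
    (forall n, n < 0 -> h n = 0) -> (forall n, h' n = h n + x * h (n - 1)) ->
  JT h' a =
  \sum_(nu | vert_strip nu a) (\prod_i x ^+ (a i - nu i)) * JT h nu.
Proof.
move=> adec h0 hE; rewrite /JT; have /weakly_decP adecP := adec.
pose F (i : 'I_l) (c : bool) (j : 'I_l) :=
  h ((a i)%:Z - c%:Z - (mu j)%:Z - i%:Z + j%:Z).
transitivity (\det (\matrix_(i, j) \sum_(c : bool) x ^+ c * F i c j)).
  congr (\det _); apply/matrixP => i j; rewrite !mxE.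
  rewrite big_bool /= hE [RHS]addrC.
  rewrite expr1 expr0 mul1r /F subr0; congr (_ + x * h _).
  by lia.
rewrite det_multilinear.
(* This says that [a - e] is a partition: no empty row is shortened, and with a row all later rows
   of the same length are shortened. *)
pose good (e : {ffun 'I_l -> bool}) := [forall i : 'I_l, e i ==>
  (0 < a i)%N && [forall j : 'I_l, (i < j)%N && (a i == a j :> nat) ==> e j]].
rewrite (bigID good) /= [X in _ + X]big1 ?addr0; last first.
  move=> e /forallPn[i0]; rewrite negb_imply negb_and => /andP[ei bad].
  rewrite [X in _ * X](_ : _ = 0) ?mulr0 //.
  have ei' : oapp e false (insub (i0 : nat)) by rewrite valK.
  (* A shortened empty row is compared with position [l], where [part_at] is 0; otherwise a
     shortened row precedes an unshortened one of equal length. *)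
  case/orP: bad => [ai0|/forallPn[j]].
    apply: (@JT_vert_cancel h a e i0 l) => //; first by rewrite ltn_ord leqnn.
      by rewrite part_atE part_at_ge //; lia.
    by rewrite insubN // ltnn.
  rewrite negb_imply => /andP[/andP[ij /eqP aij] ej].
  apply: (@JT_vert_cancel h a e i0 j) => //; first by rewrite ij ltnW.
    by rewrite !part_atE.
  by rewrite valK.
(* The good [e] correspond to the vertical strips through [nu = a - e]; the default of [insubd]
   never occurs, since [a i - e i < M]. *)
rewrite (reindex_onto (fun nu : {ffun 'I_l -> 'I_M} => [ffun i => (nu i < a i)%N])
   (fun e => [ffun i => insubd (a i) (a i - e i)%N])) /=; last first.
  move=> e /forallP ge; apply/ffunP => i; rewrite !ffunE val_insubd.
  rewrite (leq_ltn_trans (leq_subr _ _) (ltn_ord _)).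
  have := ge i; case: (e i) => /=; last by rewrite subn0 ltnn.
  by case/andP; lia.
have insubE nu : ([ffun i => insubd (a i) (a i - ([ffun i => (nu i < a i)%N] : {ffun 'I_l -> bool}) i)%N] == nu)
    = [forall i, (nu i <= a i <= (nu i).+1)%N].
  apply/eqP/forallP => [/ffunP e i|H].
    have /(congr1 val) := e i; rewrite !ffunE val_insubd /=.
    by rewrite (leq_ltn_trans (leq_subr _ _) (ltn_ord _)); lia.
  apply/ffunP => i; apply: val_inj; rewrite !ffunE val_insubd /=.
  by rewrite (leq_ltn_trans (leq_subr _ _) (ltn_ord _)); have := H i; lia.
apply: eq_big => [nu|nu].
  rewrite insubE /vert_strip; apply: andb_id2r => /forallP near.
  apply/forallP/weakly_decP => [ge i j ij|nudec i].
    move: ij; rewrite leq_eqVlt => /predU1P[/val_inj-> //|ij].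
    have := ge i; rewrite ffunE; have := near i; have := near j.
    have := adecP i j (ltnW ij).
    case: (ltnP (nu i) (a i)) => /= [_|]; last by lia.
    have [aij|] := eqVneq (a i : nat) (a j); last by lia.
    move=> ? ? ? /andP[_ /forallP/(_ j)]; rewrite ij aij eqxx ffunE /=; lia.
  apply/implyP; rewrite ffunE => ai; apply/andP; split; first by lia.
  apply/forallP => j; apply/implyP => /andP[ij /eqP aij].
  by rewrite ffunE; have := nudec i j (ltnW ij); lia.
rewrite insubE => /andP[_ /forallP near].
have E i : (nu i < a i)%N = (a i - nu i)%N :> nat by have := near i; lia.
congr (_ * _).
  by apply: eq_bigr => i _; rewrite ffunE E.
congr determinant.
apply/matrixP => i j; rewrite !mxE /F ffunE E; congr (h _).
by have := near i; lia.
Qed.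

(** A unitriangular row operation turns every [h'] entry into a finite sum of [h] entries, whose
    range is the interlacing condition on [nu i]. *)
Lemma JT_horiz (x : A) h h' a : weakly_dec a ->
    (forall n, n < 0 -> h' n = 0) -> (forall n, h' n = h n + x * h' (n - 1)) ->
  JT h' a =
  \sum_(nu | horiz_strip nu a) (\prod_i x ^+ (a i - nu i)) * JT h nu.
Proof.
move=> adec h0 hE.
have hS d n : h' n - x ^+ d.+1 * h' (n - d.+1%:Z) = \sum_(r < d.+1) x ^+ r * h (n - r%:Z).
  elim: d => [|d IH].
    by rewrite big_ord1 expr1 expr0 mul1r subr0 [h' n]hE addrK.
  rewrite big_ord_recr /= -IH.
  rewrite (hE (n - d.+1%:Z)) mulrDr mulrA -exprSr.
  rewrite (_ : n - d.+1%:Z - 1 = n - d.+2%:Z); last by lia.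
  by rewrite opprD addrA addrAC subrK.
pose E (i : nat) (j : 'I_l) : A := h' ((part_at a i)%:Z - (mu j)%:Z - i%:Z + j%:Z).
pose d i : nat := (part_at a i - part_at a i.+1)%N.
(* The indices in rows [i] and [i.+1] differ by [(d i).+1], so subtracting [x ^+ (d i).+1] times row
   [i.+1] from row [i] leaves the sum in [hS]. *)
pose U : 'M[A]_l := \matrix_(i, k) ((i == k)%:R - (k == i.+1 :> nat)%:R * x ^+ (d i).+1).
have detU : \det U = 1.
  rewrite -det_tr det_trig; last first.
    apply/is_trig_mxP => i j ij; rewrite !mxE -val_eqE /= gtn_eqF //.
    by rewrite ltn_eqF 1?ltnW // mul0r subr0.
  by apply: big1 => i _; rewrite !mxE eqxx ltn_eqF // mul0r subr0.
pose s (i : 'I_l) (c : 'I_M) : A :=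
  if (part_at a i.+1 <= c <= a i)%N then x ^+ (a i - c) else 0.
pose F (i : 'I_l) (c : 'I_M) (j : 'I_l) := h (c%:Z - (mu j)%:Z - i%:Z + j%:Z).
transitivity (\det (\matrix_(i, j) \sum_c s i c * F i c j)).
  rewrite /JT -[LHS]mul1r -detU -det_mulmx; congr (\det _).
  apply/matrixP => i j; rewrite !mxE.
  transitivity (E i j - x ^+ (d i).+1 * E i.+1 j).
    under eq_bigr => k _ do rewrite !mxE -part_atE -/(E k j) mulrBl.
    rewrite sumrB (bigD1 i) //= eqxx mul1r big1 ?addr0; last first.
      by move=> k ki; rewrite eq_sym (negbTE ki) mul0r.
    congr (_ - _); have [i1l|li1] := ltnP i.+1 l.
      rewrite (bigD1 (Ordinal i1l)) //= eqxx mul1r big1 ?addr0 // => k.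
      by rewrite -val_eqE /= => /negbTE->; rewrite !mul0r.
    (* Nothing is subtracted from the last row; the formula persists because [E i.+1 j] then has a
       negative index. *)
    rewrite big1 => [|k _]; last by rewrite ltn_eqF ?mul0r //; have := ltn_ord k; lia.
    rewrite /E part_at_ge // h0 ?mulr0 //; have := ltn_ord j; lia.
  have -> : E i.+1 j = h' ((part_at a i)%:Z - (mu j)%:Z - i%:Z + j%:Z - (d i).+1%:Z).
    have := part_at_dec adec (leqnSn i).
    by rewrite /E /d => ?; congr (h' _); lia.
  rewrite /E hS /s; under [RHS]eq_bigr => c _ do rewrite (fun_if ( *%R^~ _)) mul0r.
  rewrite -big_mkcond /=.
  have dec1 := part_at_dec adec (leqnSn i); rewrite part_atE in dec1.
  have ltM (r : nat) : (a i - r < M)%N := leq_ltn_trans (leq_subr _ _) (ltn_ord _).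
  (* The exponent [r] is the number [a i - c] of boxes removed from row [i]. *)
  rewrite (reindex_onto (fun r : 'I_(d i).+1 => insubd (a i) (a i - r)%N)
    (fun c : 'I_M => inord (a i - c))) /=; last first.
    move=> c /andP[c1 c2]; apply: val_inj.
    by rewrite val_insubd ltM /= inordK /d ?part_atE; lia.
  apply: eq_big => [r|r _].
    rewrite val_insubd ltM; have := ltn_ord r; rewrite {2}/d part_atE => rd.
    apply/esym/andP; split; first by lia.
    by rewrite subKn ?inord_val //; lia.
  rewrite /F val_insubd ltM; have := ltn_ord r; rewrite {2}/d part_atE => rd.
  congr (x ^+ _ * h _); lia.
rewrite det_multilinear (bigID (fun nu => horiz_strip nu a)) /=.
(* If [nu] is no horizontal strip, some coefficient [s i (nu i)] is 0. *)
rewrite [X in _ + X]big1 ?addr0; last first.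
  move=> nu bad; suff /existsP[i /eqP bi] : [exists i : 'I_l, s i (nu i) == 0].
    by rewrite (bigD1 i) //= bi !mul0r.
  move: bad; apply: contraNT; rewrite negb_exists => /forallP sn0.
  have cond (i : 'I_l) : (part_at a i.+1 <= nu i <= a i)%N.
    by have := sn0 i; rewrite /s; case: ifP; rewrite ?eqxx.
  apply/andP; split; apply/forallP => i; first by case/andP: (cond i).
  apply/forallP => j; apply/implyP => ij; rewrite -part_atE.
  by apply: leq_trans (part_at_dec adec ij) _; case/andP: (cond i).
apply: eq_bigr => nu /andP[/forallP H1 /forallP H2]; congr (_ * _).
apply: eq_bigr => i _; rewrite /s H1 andbT ifT //.
have [i1l|li1] := ltnP i.+1 l; last by rewrite part_at_ge.
rewrite (part_atE a (Ordinal i1l)).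
by have /forallP/(_ (Ordinal i1l))/implyP := H2 i; apply.
Qed.

End JacobiTrudi.

(** * Fillings of a rectangle *)

Section Fillings.
Context (l M L : nat) (mu : nat -> nat) (pos : nat -> bool).
Hypothesis mu_dec : forall i j, (i <= j)%N -> (mu j <= mu i)%N.
Local Notation box := ('I_l * 'I_M)%type.
Implicit Types (a nu : {ffun 'I_l -> 'I_M}) (g : {ffun box -> 'I_L.+2}) (b : box).

Definition northwest (b b' : box) : bool :=
  [&& b != b', (b.1 <= b'.1)%N & (b.2 <= b'.2)%N].

(** The padding values 0 and [L.+1] repeat freely. For other values, [samerow] replaces the
    comparison of labels, see [skew_lt_label]. *)
Definition entry_ok (x y : nat) (samerow : bool) : bool :=
  (x < y)%N || (x == y) && [|| x == 0%N, x == L.+1 | pos x == samerow].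

(* A filling of a/mu with the letters 1, ..., k, extended to the whole rectangle
   by 0 on mu and by L.+1 outside a; [pos] tells the letters which may repeat
   inside a row (the other ones may repeat inside a column). *)
Definition filling (k : nat) a g : bool :=
  [forall b : box, [&& (b.2 < mu b.1)%N == (g b == 0%N :> nat),
      (b.2 < a b.1)%N == (g b <= k)%N & (g b <= k)%N || (g b == L.+1 :> nat)]] &&
  [forall b : box, forall b' : box, northwest b b' ==>
      entry_ok (g b) (g b') (b.1 == b'.1)].

Lemma fillingP k a g :
  reflect [/\ forall b, (b.2 < mu b.1)%N = (g b == 0%N :> nat),
     forall b, (b.2 < a b.1)%N = (g b <= k)%N,
     forall b, (g b <= k)%N || (g b == L.+1 :> nat)
   & forall b b', northwest b b' -> entry_ok (g b) (g b') (b.1 == b'.1)]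
  (filling k a g).
Proof.
apply: (iffP andP) => [[/forallP h1 /forallP h2]|[h1 h2 h3 h4]].
  split=> [b|b|b|b b' bb']; try by case/and3P: (h1 b) => /eqP ? /eqP ? ?.
  by have /forallP/(_ b')/implyP := h2 b; apply.
split; first by apply/forallP => b; rewrite h1 h2 h3 !eqxx.
by apply/forallP => b; apply/forallP => b'; apply/implyP/h4.
Qed.

Definition strip (p : bool) nu a : bool :=
  if p then horiz_strip nu a else vert_strip nu a.

Lemma strip_dec p nu a : weakly_dec a -> strip p nu a -> weakly_dec nu.
Proof.
case: p => [/weakly_decP adec /andP[/forallP h1 /forallP h2]|_ /andP[]//].
apply/weakly_decP => i j; rewrite leq_eqVlt => /predU1P[/val_inj->//|ij].
by apply: leq_trans (h1 j) _; have /forallP/(_ j)/implyP := h2 i; apply.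
Qed.

Lemma strip_le p nu a i : strip p nu a -> (nu i <= a i)%N.
Proof.
by case: p => /andP[h1 h2]; [move/forallP: h1|move/forallP: h2] => /(_ i) // /andP[].
Qed.

Definition sublevel (k : nat) nu g : bool :=
  [forall b : box, (b.2 < nu b.1)%N == (g b <= k)%N].

Lemma sublevelP k nu g :
  reflect (forall b, (b.2 < nu b.1)%N = (g b <= k)%N) (sublevel k nu g).
Proof. by apply: (iffP forallP) => h b; [have /eqP := h b|rewrite h]. Qed.

Lemma sublevel_inj k nu nu' g : sublevel k nu g -> sublevel k nu' g -> nu = nu'.
Proof.
move=> /sublevelP h /sublevelP h'; apply/ffunP => i; apply: val_inj => /=.
have e (c : 'I_M) : (c < nu i)%N = (c < nu' i)%N.
  by rewrite (h (i, c)) (h' (i, c)).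
by have := e (nu i); have := e (nu' i); rewrite !ltnn; lia.
Qed.

Lemma filling_mono k a g b b' : filling k a g ->
  (b.1 <= b'.1)%N -> (b.2 <= b'.2)%N -> (g b <= g b')%N.
Proof.
move=> /fillingP[_ _ _ h] r c; have [->//|bb'] := eqVneq b b'.
have := h b b'; rewrite /northwest bb' r c => /(_ isT).
by rewrite /entry_ok => /orP[/ltnW|/andP[/eqP->]].
Qed.

(** Entries increase weakly along rows, so those at most [k] fill an initial segment of row [i], of
    length [nu i]. The boxes of [a]/[nu] carry [k.+1], whose repetition rule makes them a strip. *)
Lemma filling_sublevel k a g : (k < L)%N -> weakly_dec a -> filling k.+1 a g ->
  exists2 nu, strip (pos k.+1) nu a & sublevel k nu g.
Proof.
move=> kL /weakly_decP adec gf; have mono := filling_mono gf.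
have /fillingP[h1 h2 h3 h4] := gf.
(* Column [a i] witnesses the minimum: it lies in the rectangle, as [a i < M], and its entry exceeds
   [k]. *)
pose nu : {ffun 'I_l -> 'I_M} :=
  [ffun i => [arg min_(c < a i | ~~ (g (i, c) <= k)%N) (c : nat)]].
have nuE i : [/\ ~~ (g (i, nu i) <= k)%N, (nu i <= a i)%N &
    forall c : 'I_M, (c < nu i)%N -> (g (i, c) <= k)%N].
  rewrite /nu ffunE; case: arg_minnP => [|c c1 c2].
    by have := h2 (i, a i); rewrite /= ltnn; lia.
  split=> //; first by apply: c2; have := h2 (i, a i); rewrite /= ltnn; lia.
  by move=> c' c'c; apply: contraTT c'c => /c2; rewrite leqNgt.
have sub b : (b.2 < nu b.1)%N = (g b <= k)%N.
  case: b => i c /=; have [n1 _ n3] := nuE i.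
  have [/n3 ->//|nc] := ltnP c (nu i).
  have := mono (i, nu i) (i, c) (leqnn _) nc.
  by move=> gg; apply/esym/negbTE; rewrite -ltnNge (leq_trans _ gg) // ltnNge.
exists nu; last exact/sublevelP.
pose G (i : 'I_l) (c : 'I_M) : nat := g (i, c).
have lo (i : 'I_l) (c : 'I_M) : (nu i <= c)%N -> (k < G i c)%N.
  by rewrite leqNgt (sub (i, c)) -ltnNge.
have hi (i : 'I_l) (c : 'I_M) : (c < a i)%N -> (G i c <= k.+1)%N.
  by rewrite (h2 (i, c)).
have nudec : weakly_dec nu.
  apply/weakly_decP => i j ij; rewrite leqNgt; apply/negP => lt.
  have := sub (j, nu i); rewrite /= lt => /esym.
  have := mono (i, nu i) (j, nu i) ij (leqnn _); rewrite -!/(G _ _).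
  have := lo i (nu i) (leqnn _); lia.
(* Two distinct comparable boxes of [a]/[nu] both carry [k.+1], hence share a row exactly if
   [pos k.+1]. *)
have same (i j : 'I_l) (c d : 'I_M) : (i, c) != (j, d) -> (i <= j)%N -> (c <= d)%N ->
    (nu i <= c)%N -> (d < a j)%N -> pos k.+1 = (i == j).
  move=> ne ij cd /lo gi /hi gj.
  have := h4 (i, c) (j, d); rewrite /northwest ne ij cd => /(_ isT).
  have Gle : (G i c <= G j d)%N by exact: mono.
  have Gi : g (i, c) = k.+1 :> nat by rewrite -/(G i c); lia.
  have Gj : g (j, d) = k.+1 :> nat by rewrite -/(G j d); lia.
  by rewrite /entry_ok Gi Gj ltnn eqxx eqSS (ltn_eqF kL) => /eqP.
rewrite /strip; case: ifP => pk; apply/andP; split=> //; apply/forallP => i.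
- by case: (nuE i).
- apply/forallP => j; apply/implyP => ij; rewrite leqNgt; apply/negP => lt.
  have nij : i == j = false by rewrite -val_eqE /= ltn_eqF.
  have := same i j (nu i) (nu i); rewrite -pair_eqE /= nij (ltnW ij) leqnn lt pk.
  by move=> /(_ isT isT isT isT isT).
case: (nuE i) => _ -> _ /=; rewrite leqNgt; apply/negP => lt.
have ltM : ((nu i).+1 < M)%N by apply: ltn_trans lt _.
have := same i i (nu i) (Ordinal ltM); rewrite -pair_eqE /= -(val_eqE (nu i)) /=.
rewrite ltn_eqF // andbF eqxx pk => /(_ isT (leqnn _) (leqnSn _) (leqnn _) lt).
by [].
Qed.

(** Forgetting the letter [k.+1] and writing it back with [grow] are inverse bijections; they yield
    the recursion [filling_sumS]. *)
Definition shrink (k : nat) g : {ffun box -> 'I_L.+2} :=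
  [ffun b => if (g b <= k)%N then g b else ord_max].

Definition grow (k : nat) a g : {ffun box -> 'I_L.+2} :=
  [ffun b => if (g b <= k)%N then g b
             else if (b.2 < a b.1)%N then inord k.+1 else ord_max].

Lemma shrinkE k g b : shrink k g b = (if (g b <= k)%N then g b : nat else L.+1) :> nat.
Proof. by rewrite ffunE; case: ifP. Qed.

Lemma growE k a g b : (k < L)%N ->
  grow k a g b = (if (g b <= k)%N then g b : nat
                    else if (b.2 < a b.1)%N then k.+1 else L.+1) :> nat.
Proof. by move=> kL; rewrite ffunE; do 2?[case: ifP => //= _]; rewrite inordK; lia. Qed.

Lemma growK k a g : (k < L)%N ->
  (forall b, (g b <= k)%N || (g b == L.+1 :> nat)) -> shrink k (grow k a g) = g.
Proof.
move=> kL h; apply/ffunP => b; rewrite !ffunE; apply: val_inj.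
have := h b; case: (leqP (g b) k) => [gk|gk /= /eqP gL]; first by rewrite gk.
rewrite gL ifF //; apply/negbTE; rewrite -ltnNge.
by case: ifP => _; rewrite ?inordK /=; lia.
Qed.

Lemma shrinkK k a g : (k < L)%N -> filling k.+1 a g -> grow k a (shrink k g) = g.
Proof.
move=> kL /fillingP[_ h2 h3 _]; apply/ffunP => b; rewrite !ffunE; apply: val_inj.
case: (leqP (g b) k) => [gk|gk /=]; first by rewrite gk.
rewrite ifN /=; last by lia.
by have := h2 b; have := h3 b; case: ifP; rewrite ?inordK /=; lia.
Qed.

Lemma shrink_filling k nu a g : (k < L)%N -> filling k.+1 a g -> sublevel k nu g ->
  filling k nu (shrink k g).
Proof.
move=> kL gf /sublevelP sub; have mono := filling_mono gf.
have /fillingP[h1 h2 h3 h4] := gf; apply/fillingP; split=> [b|b|b|b b' bb'].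
- by rewrite h1 shrinkE; case: ifP => //=; lia.
- by rewrite sub shrinkE; case: ifP => //=; lia.
- by rewrite shrinkE; case: ifP => //=; lia.
have := h4 b b' bb'; have /and3P[_ r c] := bb'; have := mono _ _ r c.
rewrite !shrinkE /entry_ok.
case: (leqP (g b) k) => gb; case: (leqP (g b') k) => gb' //=; [lia|lia|].
by rewrite eqxx orbT.
Qed.

Lemma grow_filling k nu a g : (k < L)%N -> weakly_dec a ->
    strip (pos k.+1) nu a -> filling k nu g ->
  filling k.+1 a (grow k a g) && sublevel k nu (grow k a g).
Proof.
move=> kL adec st gf; have nudec := strip_dec adec st; have le i := strip_le i st.
have mono := filling_mono gf.
have /fillingP[h1 h2 h3 h4] := gf; apply/andP; split; last first.
  apply/sublevelP => b; rewrite h2 ffunE.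
  by case: ifP => //= _; case: ifP => _; rewrite ?inordK /=; lia.
have E := growE a g _ kL.
apply/fillingP; split=> [b|b|b|b b' bb'].
- by rewrite h1 E; case: ifP => // gb; case: ifP => _; lia.
- rewrite E; have := h2 b; have := le b.1.
  by case: (leqP (g b) k); case: (ltnP b.2 (a b.1)); lia.
- by rewrite E; case: ifP => gb; [|case: ifP => _]; lia.
have := h4 b b' bb'; have /and3P[neq r c] := bb'; have := mono _ _ r c.
have nuE b0 : (nu b0.1 <= b0.2)%N = (k < g b0)%N by rewrite leqNgt h2 -ltnNge.
clear h1 h2 h3 h4 mono; rewrite !E /entry_ok.
have [gb|gb] := leqP (g b) k; have [gb'|gb'] := leqP (g b') k => //.
- move=> _ _; apply/orP; left; case: ifP => _; first by rewrite ltnS.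
  by rewrite ltnS (leq_trans gb) // ltnW.
- by move=> /leq_trans/(_ gb'); rewrite leqNgt gb.
have ar : (a b'.1 <= a b.1)%N by move/weakly_decP: adec; apply.
have nb : (nu b.1 <= b.2)%N by rewrite nuE.
have nb' : (nu b'.1 <= b'.2)%N by rewrite nuE.
case: (ltnP b.2 (a b.1)) => ab; case: (ltnP b'.2 (a b'.1)) => ab' _ _.
(* Two comparable boxes of [a]/[nu] lie in one row for a horizontal strip and in different rows for
   a vertical one. *)
- clear E le nuE gb gb'; rewrite ltnn eqxx /= eqSS; apply/orP; right.
  move: st; rewrite /strip; case: ifP => [_ /andP[_ /forallP st]|_ /andP[_ /forallP st]].
    rewrite eq_sym eqb_id -val_eqE eqn_leq r /= leqNgt; apply/negP => lt.
    by have /forallP/(_ b'.1)/implyP/(_ lt) := st b.1; lia.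
  rewrite eq_sym eqbF_neg; apply/eqP => e; have := st b.1.
  rewrite -e in ab' nb'; case/andP => _; move: neq.
  rewrite -pair_eqE /= -e eqxx -val_eqE /=; lia.
- by rewrite ltnS kL.
- by have := leq_trans ab' (leq_trans ar (leq_trans ab c)); rewrite ltnn.
by rewrite eqxx orbT.
Qed.

(** * Weighted sums over fillings *)

Section Weights.
Context (A : comNzRingType) (w : nat -> A).

(** The padding has weight 1, so products can run over the whole rectangle. *)
Definition letter_weight (x : nat) : A := if (0 < x <= L)%N then w x else 1.

Definition filling_sum (k : nat) a : A :=
  \sum_(g | filling k a g) \prod_b letter_weight (g b).

Lemma filling_sum0 a : weakly_dec a ->
  filling_sum 0 a = [forall i, a i == mu i :> nat]%:R.
Proof.
move=> /weakly_decP adec; rewrite /filling_sum.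
case: (boolP [forall i : 'I_l, a i == mu i :> nat]) => [/forallP aE|/forallPn[i ai]]; last first.
  rewrite big1 // => g /fillingP[h1 h2 _ _].
  have e (c : 'I_M) : (c < mu i)%N = (c < a i)%N.
    by rewrite (h1 (i, c)) (h2 (i, c)) leqn0.
  (* Testing column [a i] gives [mu i <= a i]; only then is [mu i] known to be a column of the
     rectangle. *)
  have := e (a i); rewrite ltnn => ami; have mia : (mu i < a i)%N by lia.
  have := e (Ordinal (ltn_trans mia (ltn_ord _))) => /=; lia.
pose g0 : {ffun box -> 'I_L.+2} := [ffun b : box => if (b.2 < mu b.1)%N then ord0 else ord_max].
rewrite (big_pred1 g0).
  rewrite big1 // => b _; rewrite /g0 ffunE /letter_weight.
  by case: (ltnP b.2 (mu b.1)) => _ /=; rewrite ?ltnn.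
move=> g; apply/fillingP/eqP => [[h1 h2 h3 h4]|->].
  apply/ffunP => b; apply: val_inj; rewrite ffunE h1.
  by have := h3 b; rewrite leqn0; case: ifP => /= [/eqP|_ /eqP].
split=> [b|b|b|b b' /and3P[_ r c]]; rewrite !ffunE /=.
- by case: ifP.
- by rewrite (eqP (aE _)); case: ifP.
- by case: ifP => //= _; rewrite eqxx orbT.
have := mu_dec r; rewrite /entry_ok.
case: (ltnP b.2); case: (ltnP b'.2) => //=; [lia|by rewrite eqxx orbT].
Qed.

Lemma prod_strip (x : A) nu a :
  \prod_(b : box) (if (nu b.1 <= b.2 < a b.1)%N then x else 1) =
  \prod_i x ^+ (a i - nu i).
Proof.
rewrite -(pair_bigA _ (fun (i : 'I_l) (c : 'I_M) => if (nu i <= c < a i)%N then x else 1)).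
apply: eq_bigr => i _; rewrite -big_mkcond /=.
rewrite -prodr_const_nat (big_nat_widen _ _ M) 1?ltnW //= big_geq_mkord.
by apply: eq_bigl => c; rewrite andbC.
Qed.

(** Fillings are grouped by the unique shape [nu] of their entries at most [k]; each box of [a]/[nu]
    contributes a factor [w k.+1]. *)
Lemma filling_sumS k a : (k < L)%N -> weakly_dec a ->
  filling_sum k.+1 a =
  \sum_(nu | strip (pos k.+1) nu a) (\prod_i w k.+1 ^+ (a i - nu i)) * filling_sum k nu.
Proof.
move=> kL adec; rewrite /filling_sum.
transitivity (\sum_(g | filling k.+1 a g)
    \sum_(nu | strip (pos k.+1) nu a && sublevel k nu g) \prod_b letter_weight (g b)).
  apply: eq_bigr => g /(filling_sublevel kL adec)[nu st sub].
  rewrite (big_pred1 nu) // => nu'; apply/andP/eqP => [[_ sub']|->//].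
  exact: sublevel_inj sub' sub.
rewrite (exchange_big_dep (fun nu => strip (pos k.+1) nu a)) /=; last first.
  by move=> g nu _ /andP[].
apply: eq_bigr => nu st.
rewrite (reindex_onto (grow k a) (shrink k)) /=; last first.
  by move=> g /andP[gf _]; exact: shrinkK.
rewrite mulr_sumr; apply: eq_big => [g|g].
  rewrite st /=; apply/andP/idP => [[/andP[gf sub] /eqP <-]|gf].
    exact: shrink_filling gf sub.
  rewrite grow_filling // growK //.
  by case/fillingP: gf.
move=> /andP[/and3P[gf _ sub] /eqP gE].
have gk : filling k nu g by rewrite -gE; exact: shrink_filling gf sub.
have /fillingP[h1 h2 h3 h4] := gk.
rewrite -prod_strip -big_split; apply: eq_bigr => b _ /=.
have nuE : (nu b.1 <= b.2)%N = (k < g b)%N by rewrite leqNgt h2 -ltnNge.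
rewrite growE // nuE; have := h3 b.
case: (leqP (g b) k) => gb /=; first by rewrite mul1r.
move=> /eqP ->; rewrite {2}/letter_weight ltnn andbF mulr1.
by case: ifP => _; rewrite /letter_weight /= ?ltnn ?kL.
Qed.

(** The last recursion says that the generating function of [H k] is divided by [1 - w k.+1 u] if
    [pos k.+1] and multiplied by [1 + w k.+1 u] otherwise. Both sides then remove the same
    strips. *)
Lemma JT_filling (H : nat -> int -> A) k a :
    (forall n, H 0%N n = (n == 0)%:R) ->
    (forall k n, n < 0 -> H k n = 0) ->
    (forall k n, (k < L)%N -> H k.+1 n =
       H k n + w k.+1 * (if pos k.+1 then H k.+1 (n - 1) else H k (n - 1))) ->
    (k <= L)%N -> weakly_dec a ->
  JT mu (H k) a = filling_sum k a.
Proof.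
move=> H0 Hneg HS; elim: k a => [|k IH] a kL adec.
  rewrite filling_sum0 // -(JT_delta A mu_dec adec).
  by congr determinant; apply/matrixP => i j; rewrite !mxE H0.
have hS n := HS k n kL.
rewrite filling_sumS //.
transitivity (\sum_(nu | strip (pos k.+1) nu a)
  (\prod_i w k.+1 ^+ (a i - nu i)) * JT mu (H k) nu).
  by case: (pos k.+1) hS => hS; [apply: JT_horiz|apply: JT_vert]; auto.
by apply: eq_bigr => nu st; rewrite IH 1?ltnW //; exact: strip_dec st.
Qed.

End Weights.
End Fillings.

(** * Hall-Littlewood functions in finitely many indeterminates *)

Section Agreement.
Context (K : comNzRingType) (N : nat).
Implicit Types (f g : fps nat K) (m : {cmonom nat}).

Definition in_vars m : Prop := forall i, (N <= i)%N -> m i = 0%N.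

(* Congruence modulo the closed ideal generated by x_ N, x_ N.+1, ... *)
Definition agree f g : Prop := forall m, in_vars m -> f m = g m.

Lemma agree_refl f : agree f f. Proof. by []. Qed.

Lemma agreeD f f' g g' : agree f f' -> agree g g' -> agree (f + g) (f' + g').
Proof. by move=> ff' gg' m mN; rewrite !fcoefD ff' ?gg'. Qed.

(** Factors of a monomial in the first [N] indeterminates involve only these. *)
Lemma agreeM f f' g g' : agree f f' -> agree g g' -> agree (f * g) (f' * g').
Proof.
move=> ff' gg' m mN; rewrite !fcoefM; apply: eq_fsbigr => -[x y] /=.
rewrite inE /factors /= => xy.
have E i : m i = (x i + y i)%N by rewrite -xy cmM.
by rewrite ff' ?gg' // => i /mN; rewrite E; lia.
Qed.

Lemma agree_det n (B C : 'M[fps nat K]_n) :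
  (forall i j, agree (B i j) (C i j)) -> agree (\det B) (\det C).
Proof.
move=> BC; rewrite /determinant.
apply: (big_ind2 agree) => [||s _]; [exact: agree_refl|exact: agreeD|].
apply: agreeM; first exact: agree_refl.
by apply: (big_ind2 agree) => [||i _]; [exact: agree_refl|exact: agreeM|exact: BC].
Qed.

End Agreement.

Section HallLittlewoodCoefficients.
Context (K : comNzRingType).
Implicit Types (t : K) (n : int).
Local Notation x_ := (@fvar nat K).

Definition HL_trunc t (M : nat) n : fps nat K :=
  if n is Posz k then (\prod_(i < M) HL_factor t i) (upow k) else 0.

Lemma upowE k : upow k tt = k.
Proof.
case: k => [|k]; first by rewrite cm1.
by rewrite /upow /expcmn iteropS; elim: k => [|k IH]; rewrite ?cmU // cmM IH cmU.
Qed.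

Lemma upow_eq1 k : (upow k == mone) = (k == 0%N).
Proof.
apply/eqP/eqP => [/eqP/cmP/(_ tt)|->].
  by rewrite upowE cm1.
by apply/eqP/cmP => -[]; rewrite upowE ?cm1.
Qed.

Lemma coef_mul_1subu (P : fps unit (fps nat K)) (a : fps nat K) (k : nat) :
  (P * (1 - a *: fvar _ tt)) (upow k) =
  P (upow k) - a * (if k is k'.+1 then P (upow k') else 0).
Proof.
rewrite mulrBr mulr1 -scalerAr fcoefB fcoefZ fcoefMvar.
rewrite upowE; case: k => [|k] //=; congr (_ - _ * P _).
by apply/eqP/cmP => -[]; rewrite divcmE cmU (upowE k.+1) (upowE k) eqxx subn1.
Qed.

Lemma HL_trunc0 t n : HL_trunc t 0 n = (n == 0)%:R.
Proof.
case: n => [k|k] //=; rewrite big_ord0 fcoef1 upow_eq1; by case: k.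
Qed.

Lemma HL_trunc_neg t M n : n < 0 -> HL_trunc t M n = 0.
Proof. by case: n. Qed.

(** Multiplying the product of [M.+1] factors by the unit [1 - x_ M u] clears the last denominator;
    coefficients of [u] are then compared. *)
Lemma HL_truncS t M n :
  HL_trunc t M.+1 n = HL_trunc t M n - (t *: x_ M) * HL_trunc t M (n - 1)
                      + x_ M * HL_trunc t M.+1 (n - 1).
Proof.
case: n => [k|k]; last first.
  by rewrite !HL_trunc_neg ?mulr0 ?subr0 ?addr0 //; lia.
have pred (P : fps unit (fps nat K)) :
    (if k is k'.+1 then P (upow k') else 0) = (if k%:Z - 1 is Posz k' then P (upow k') else 0).
  by case: k => // k; rewrite (_ : k.+1%:Z - 1 = k) //; lia.
apply/eqP; rewrite -subr_eq /HL_trunc -!pred -!coef_mul_1subu big_ord_recr /= -mulrA.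
by rewrite /HL_factor divrK ?one_sub_unit.
Qed.

Lemma agree_mulvar N M f : (N <= M)%N -> agree N (x_ M * f) 0.
Proof. by move=> NM m mN; rewrite mulrC fcoefMvar mN. Qed.

(** Modulo [x_ M] the factor of index [M] is 1. *)
Lemma agree_HL_trunc t N M n : (N <= M)%N -> agree N (HL_trunc t M n) (HL_trunc t N n).
Proof.
elim: M => [|M IH]; first by rewrite leqn0 => /eqP->.
rewrite leq_eqVlt => /predU1P[-> //|NM] m mN; rewrite HL_truncS.
rewrite fcoefD fcoefB -scalerAl fcoefZ !(@agree_mulvar N M) // mulr0 subr0 addr0.
exact: IH.
Qed.

Lemma agree_HL_q t N n : agree N (HL_q t n) (HL_trunc t N n).
Proof.
case: n => [k|k] // m mN; have [N' cvg] := HL_gen_cvg t (upow k) m.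
rewrite [LHS](cvg (maxn N N')) ?leq_maxr //.
exact: (@agree_HL_trunc t N (maxn N N') k (leq_maxl _ _)).
Qed.

(* The first k letters of -1, 1, -2, 2, ... : an odd k ends with a negative
   letter, whose factor 1 + q x_ k./2 u is not yet paired with 1 - x_ k./2 u. *)
Definition HL_letter (q : K) (k : nat) n : fps nat K :=
  HL_trunc (- q) k./2 n +
  (if odd k then (q *: x_ k./2) * HL_trunc (- q) k./2 (n - 1) else 0).

(** The letters -k and k have numbers 2k-1 and 2k; in both cases [x.-1./2] is k-1, the index of the
    k-th indeterminate counted from 0. *)
Definition letter_wt (q : K) (x : nat) : fps nat K := q ^+ odd x *: x_ x.-1./2.

(** A negative letter adds the numerator [1 + q x u], which is how [HL_letter] is defined at odd
    [k]. The positive letter completes the factor of [HL_trunc] at [t = - q], by [HL_truncS]. *)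
Lemma HL_letterS q k n :
  HL_letter q k.+1 n = HL_letter q k n + letter_wt q k.+1 *
    (if ~~ odd k.+1 then HL_letter q k.+1 (n - 1) else HL_letter q k (n - 1)).
Proof.
rewrite /HL_letter /letter_wt /= uphalf_half; case: (odd k) => /=.
  by rewrite !addr0 add1n HL_truncS scaleNr mulNr opprK expr0 scale1r.
by rewrite !addr0 expr1.
Qed.

End HallLittlewoodCoefficients.

(* The letters -1, 1, -2, 2, ... are numbered 1, 2, 3, 4, ... *)
Definition int_of_letter (x : nat) : int :=
  if odd x then - (uphalf x)%:Z else (x./2)%:Z.

Definition letter_of_int (a : int) : nat := (`|a|.*2 - (a < 0)%R)%N.

Lemma int_of_letterK x : letter_of_int (int_of_letter x) = x.
Proof.
rewrite /letter_of_int /int_of_letter; have := odd_double_half x.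
rewrite uphalf_half; case: (odd x) => /=; lia.
Qed.

Lemma letter_of_Negz k : letter_of_int (Negz k) = k.*2.+1.
Proof. by rewrite /letter_of_int /= doubleS subn1. Qed.

Lemma letter_of_Posz k : letter_of_int (Posz k) = k.*2.
Proof. by rewrite /letter_of_int /= subn0. Qed.

Lemma letter_of_intK a : a != 0 -> int_of_letter (letter_of_int a) = a.
Proof.
case: a => k k0; rewrite /int_of_letter ?letter_of_Posz ?letter_of_Negz /=.
  by rewrite odd_double doubleK.
by rewrite odd_double /= doubleK NegzE.
Qed.

Lemma pm_lt_letter a b : a != 0 -> b != 0 ->
  pm_lt a b = (letter_of_int a < letter_of_int b)%N.
Proof. rewrite /pm_lt /letter_of_int; lia. Qed.

Lemma odd_letter a : a != 0 -> odd (letter_of_int a) = (a < 0).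
Proof.
by case: a => k k0; rewrite ?letter_of_Posz ?letter_of_Negz /= odd_double.
Qed.

(** * The labelling of the boxes *)

Definition label_order (p p' : nat * nat) : bool :=
  (p'.1 < p.1)%N || (p.1 == p'.1) && (p.2 < p'.2)%N.

Lemma mem_skew_boxes (la mu : seq nat) (r c : nat) :
  ((r, c) \in skew_boxes la mu) =
  (r < size la)%N && (nth 0%N mu r <= c < nth 0%N la r)%N.
Proof.
apply/flatten_mapP/idP => [[j]|/andP[rl cc]].
  rewrite mem_rev mem_iota => /andP[_ jl] /mapP[d].
  by rewrite mem_iota => dd [-> ->]; lia.
exists r; first by rewrite mem_rev mem_iota.
by apply/mapP; exists c => //; rewrite mem_iota; lia.
Qed.

Lemma pairwise_skew_boxes la mu : pairwise label_order (skew_boxes la mu).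
Proof.
rewrite /skew_boxes; elim: (size la) => [|l IH] //.
rewrite -addn1 iotaD cats1 rev_rcons /= pairwise_cat IH andbT; apply/andP; split.
  apply/allrelP => p p' /mapP[c _ ->] /flatten_mapP[j].
  rewrite mem_rev mem_iota => /andP[_ jl] /mapP[d _ ->].
  by rewrite /label_order /= jl.
rewrite pairwise_map (@sub_pairwise _ ltn) //.
  by move=> c d /= cd; rewrite /label_order /= eqxx cd orbT.
by rewrite -sorted_pairwise ?iota_ltn_sorted //; exact: ltn_trans.
Qed.

Lemma skew_box_order la mu (i j : 'I_(skew_size la mu)) : skew_shape la mu ->
  (i < j)%N -> label_order (skew_box i) (skew_box j).
Proof.
move=> sh ij; have /(pairwiseP (0%N, 0%N)) := pairwise_skew_boxes la mu.
by apply => //; rewrite inE size_skew_boxes.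
Qed.

Lemma part_nth_dec la i j : is_part la -> (i <= j)%N ->
  (nth 0%N la j <= nth 0%N la i)%N.
Proof.
case/andP=> srt _ ij; have [jl|lj] := ltnP j (size la); last by rewrite nth_default.
by apply: (sorted_leq_nth _ _ _ srt) => //; rewrite ?inE ?(leq_ltn_trans ij) //;
  [exact: rev_trans leq_trans|exact: leqnn].
Qed.

(** * Enriched P-partitions as fillings *)

Section GammaFillings.
Context (la mu : seq nat) (N : nat).
Hypothesis sh : skew_shape la mu.
Local Notation l := (size la).
(** One column more than the first row, so that all parts of [la] are elements of ['I_M]. The [N.*2]
    letters are those of absolute value at most [N]. *)
Local Notation M := (nth 0%N la 0).+1.
Local Notation L := N.*2.
Local Notation n := (skew_size la mu).
Local Notation muf := (nth 0%N mu).
Local Notation box := ('I_l * 'I_M)%type.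
Local Notation pos := (fun x : nat => ~~ odd x).

Let la_part : is_part la. Proof. by case/and4P: sh. Qed.
Let mu_part : is_part mu. Proof. by case/and4P: sh. Qed.

Definition outer_shape : {ffun 'I_l -> 'I_M} := [ffun k : 'I_l => inord (nth 0%N la k)].

Lemma outer_shapeE k : outer_shape k = nth 0%N la k :> nat.
Proof. by rewrite ffunE inordK // ltnS part_nth_dec. Qed.

Lemma outer_shape_dec : weakly_dec outer_shape.
Proof. by apply/weakly_decP => i j ij; rewrite !outer_shapeE part_nth_dec. Qed.

Lemma skew_box_in (i : 'I_n) :
  ((skew_box i).1 < l)%N && (muf (skew_box i).1 <= (skew_box i).2 < nth 0%N la (skew_box i).1)%N.
Proof.
by rewrite -mem_skew_boxes -surjective_pairing mem_nth ?size_skew_boxes.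
Qed.

Lemma skew_row_lt (i : 'I_n) : ((skew_box i).1 < l)%N.
Proof. by case/andP: (skew_box_in i). Qed.

Lemma skew_col_lt (i : 'I_n) : ((skew_box i).2 < M)%N.
Proof.
case/and3P: (skew_box_in i) => _ _ /leq_trans -> //.
by rewrite leqW // part_nth_dec.
Qed.

Definition box_of (i : 'I_n) : box := (Ordinal (skew_row_lt i), Ordinal (skew_col_lt i)).

Lemma box_of_inj : injective box_of.
Proof.
move=> i j [e1 e2]; apply: val_inj; apply/eqP.
rewrite -(nth_uniq (0%N, 0%N) _ _ (uniq_skew_boxes la mu)) ?size_skew_boxes ?ltn_ord //.
by rewrite -!/(skew_box _) -pair_eqE /= e1 e2 !eqxx.
Qed.

Lemma box_of_codom (b : box) :
  (b \in codom box_of) = (muf b.1 <= b.2 < outer_shape b.1)%N.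
Proof.
rewrite outer_shapeE; apply/codomP/idP => [[j ->]|].
  by case/andP: (skew_box_in j).
case: b => r c /= rc.
have rcin : ((r : nat, c : nat)) \in skew_boxes la mu by rewrite mem_skew_boxes ltn_ord.
have lt : (index (r : nat, c : nat) (skew_boxes la mu) < n)%N.
  by rewrite -(size_skew_boxes sh) index_mem.
exists (Ordinal lt); rewrite /box_of.
have E : skew_box (Ordinal lt) = (r : nat, c : nat) by rewrite /skew_box nth_index.
by congr pair; apply: val_inj; rewrite /= E.
Qed.

Lemma skew_ltE (i j : 'I_n) : skew_lt i j = northwest (box_of i) (box_of j).
Proof. by rewrite /northwest /skew_lt (inj_eq box_of_inj). Qed.

(** A box northwest of another has the smaller label if it stands to its left in the same row, and
    the larger one if its row is higher. *)
Lemma skew_lt_label (i j : 'I_n) : skew_lt i j ->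
  (i < j)%N = ((box_of i).1 == (box_of j).1).
Proof.
case/and3P => nij r c; rewrite -val_eqE /=.
move: nij; rewrite -val_eqE neq_ltn => /orP[ij|ji].
  by rewrite ij; have := skew_box_order sh ij; rewrite /label_order; lia.
rewrite ltnNge ltnW //=; have := skew_box_order sh ji; rewrite /label_order; lia.
Qed.

Lemma entry_okE (a b : int) (s : bool) : a != 0 -> b != 0 -> (`|b| <= N)%N ->
  reflect (pm_lt a b \/ a = b /\ (if s then 0 < a else a < 0))
    (entry_ok L pos (letter_of_int a) (letter_of_int b) s).
Proof.
move=> a0 b0 bN; rewrite /entry_ok pm_lt_letter // odd_letter //.
have -> : (~~ (a < 0) == s) = (if s then 0 < a else a < 0) by case: s; lia.
have a1 : (letter_of_int a == 0%N) = false by rewrite /letter_of_int; lia.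
apply: (iffP orP) => [[->|/andP[/eqP ab]]|[->|[<- ->]]]; [by left| |by left|]; last first.
  by right; rewrite eqxx !orbT.
(* The bound on [b] keeps the common letter away from the padding value [L.+1]. *)
have bL : (letter_of_int b == L.+1) = false by rewrite /letter_of_int; lia.
rewrite a1 ab bL /= => sa; right; split=> //.
by rewrite -(letter_of_intK a0) ab letter_of_intK.
Qed.

Local Notation good := (@filling l M L muf pos L outer_shape).

Definition partition_of (g : {ffun box -> 'I_L.+2}) : {ffun 'I_n -> int} :=
  [ffun i => int_of_letter (g (box_of i))].

Lemma good_codom g b : good g -> (b \in codom box_of) = (0 < g b <= L)%N.
Proof.
by case/fillingP => h1 h2 _ _; rewrite box_of_codom h2 leqNgt h1 -lt0n.
Qed.

Lemma good_box g i : good g -> (0 < g (box_of i) <= L)%N.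
Proof. by move=> /good_codom <-; exact: codom_f. Qed.

Lemma partition_of_neq0 g i : good g -> partition_of g i != 0.
Proof.
move=> /(@good_box _ i)/andP[g0 _]; rewrite ffunE; apply: contraTneq g0 => e.
by rewrite -(int_of_letterK (g _)) e.
Qed.

Lemma letter_partition_of g i : letter_of_int (partition_of g i) = g (box_of i).
Proof. by rewrite ffunE int_of_letterK. Qed.

Lemma partition_of_le g i : good g -> (`|partition_of g i| <= N)%N.
Proof.
move=> gg; have /andP[_] := good_box i gg; rewrite -letter_partition_of.
by rewrite /letter_of_int; lia.
Qed.

Lemma partition_of_enriched g : good g -> enriched (@skew_lt la mu) (partition_of g).
Proof.
move=> gg; have n0 i := partition_of_neq0 i gg; have le i := partition_of_le i gg.
have /fillingP[_ _ _ h4] := gg.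
have key i j : skew_lt i j -> pm_lt (partition_of g i) (partition_of g j) \/
    partition_of g i = partition_of g j /\
    (if (i < j)%N then 0 < partition_of g i else partition_of g i < 0).
  move=> ij; rewrite (skew_lt_label ij).
  apply/entry_okE => //; rewrite !letter_partition_of; apply: h4.
  by rewrite -skew_ltE.
split=> // i j ij lt; have := key i j ij; first by rewrite lt.
by rewrite ltnNge ltnW.
Qed.

Lemma partition_of_inj g g' : good g -> good g' ->
  partition_of g = partition_of g' -> g = g'.
Proof.
move=> gg gg' e; apply/ffunP => b; apply: val_inj => /=.
have [/codomP[j ->]|] := boolP (b \in codom box_of).
  by rewrite -!letter_partition_of e.
rewrite box_of_codom.
case/fillingP: gg => h1 h2 h3 _; case/fillingP: gg' => h1' h2' h3' _.
have [bmu _|bmu /= bla] := ltnP b.2 (muf b.1).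
  by have := h1 b; have := h1' b; rewrite bmu => /esym/eqP-> /esym/eqP->.
by have := h3 b; have := h3' b; rewrite -h2 -h2' (negbTE bla) => /eqP-> /eqP->.
Qed.

(** The values of [f] are padded by 0 on [mu] and by [L.+1] outside [la]. As both are partitions,
    the padding respects the northwest order. *)
Lemma partition_of_surj f : enriched (@skew_lt la mu) f -> (forall i, (`|f i| <= N)%N) ->
  exists2 g, good g & partition_of g = f.
Proof.
move=> [f0 f1 f2] fN.
pose g : {ffun box -> 'I_L.+2} := [ffun b : box => if (b.2 < muf b.1)%N then ord0 else
  if [pick i | box_of i == b] is Some i then inord (letter_of_int (f i)) else ord_max].
have fL i : (0 < letter_of_int (f i) <= L)%N.
  by have := f0 i; have := fN i; rewrite /letter_of_int; lia.
have gbox i : g (box_of i) = letter_of_int (f i) :> nat.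
  have /andP[mui _] : (muf (box_of i).1 <= (box_of i).2 < outer_shape (box_of i).1)%N.
    by rewrite -box_of_codom codom_f.
  rewrite [g _]ffunE ltnNge mui /=.
  case: pickP => [j /eqP/box_of_inj ->|/(_ i)]; last by rewrite eqxx.
  by rewrite inordK //; have := fL i; lia.
have gmu (b : box) : (b.2 < muf b.1)%N -> g b = 0%N :> nat by rewrite ffunE => ->.
have gla (b : box) : (muf b.1 <= b.2)%N -> (outer_shape b.1 <= b.2)%N -> g b = L.+1 :> nat.
  move=> bmu bla; rewrite ffunE ltnNge bmu /=; case: pickP => // j /eqP bj.
  have : b \in codom box_of by rewrite -bj codom_f.
  by rewrite box_of_codom ltnNge bla andbF.
have gin (b : box) : (muf b.1 <= b.2)%N -> (b.2 < outer_shape b.1)%N -> exists i, b = box_of i.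
  by move=> b1 b2; apply/codomP; rewrite box_of_codom b1 b2.
have mula (b : box) : (b.2 < muf b.1)%N -> (b.2 < outer_shape b.1)%N.
  move=> /leq_trans; apply; rewrite outer_shapeE; case/and4P: sh => _ _ _ /allP sub.
  have [lt|ge] := ltnP b.1 (size mu); last by rewrite nth_default.
  by apply: sub; rewrite mem_iota.
exists g; last first.
  by apply/ffunP => i; rewrite ffunE gbox letter_of_intK.
apply/fillingP; split=> [b|b|b|b b' bb'].
- case: (ltnP b.2 (muf b.1)) => [/gmu->//|bmu].
  case: (ltnP b.2 (outer_shape b.1)) => [/(gin _ bmu)[j ->]|/(gla _ bmu)->//].
  by rewrite gbox; have := fL j; case: (letter_of_int _).
- case: (ltnP b.2 (muf b.1)) => [bmu|bmu]; first by rewrite mula // gmu.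
  case: (ltnP b.2 (outer_shape b.1)) => [/(gin _ bmu)[j ->]|/(gla _ bmu)->].
    by rewrite gbox; case/andP: (fL j) => _ ->.
  by rewrite ltnn.
- case: (ltnP b.2 (muf b.1)) => [/gmu->//|bmu].
  case: (ltnP b.2 (outer_shape b.1)) => [/(gin _ bmu)[j ->]|/(gla _ bmu)->].
    by rewrite gbox; case/andP: (fL j) => _ ->.
  by rewrite eqxx orbT.
have /and3P[_ r c] := bb'; rewrite /entry_ok.
have [bmu|bmu] := ltnP b.2 (muf b.1).
  by rewrite (gmu _ bmu); case: (nat_of_ord _).
have bmu' : (muf b'.1 <= b'.2)%N.
  by apply: leq_trans (leq_trans bmu c); exact: part_nth_dec.
have [bla'|bla'] := ltnP b'.2 (outer_shape b'.1); last first.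
  rewrite (gla _ bmu' bla') ltnS; have [bla|bla] := ltnP b.2 (outer_shape b.1).
    by have [j ->] := gin _ bmu bla; rewrite gbox; case/andP: (fL j) => _ ->.
  by rewrite (gla _ bmu bla) eqxx /= orbT.
have bla : (b.2 < outer_shape b.1)%N.
  apply: leq_ltn_trans c (leq_trans bla' _).
  by move/weakly_decP: outer_shape_dec; apply.
have [i bi] := gin _ bmu bla; have [j bj] := gin _ bmu' bla'.
move: bb'; rewrite bi bj !gbox -skew_ltE => ij.
rewrite -/(entry_ok L pos _ _ _); apply/entry_okE => //.
rewrite -(skew_lt_label ij); case: ltngtP => [lt|lt|/val_inj e].
- exact: f1.
- exact: f2.
by move: ij; rewrite e /skew_lt eqxx.
Qed.

Lemma Gamma_term_partition_of (K : comNzRingType) (q : K) g : good g ->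
  Gamma_term q (partition_of g) = \prod_b letter_weight L (letter_wt q) (g b).
Proof.
move=> gg; rewrite (bigID (mem (box_of @: 'I_n))) /= [X in _ * X]big1 ?mulr1; last first.
  move=> b; rewrite /letter_weight -(good_codom b gg).
  by case: (boolP (b \in codom _)) => // /codomP[j ->]; rewrite imset_f.
rewrite big_imset /=; last by move=> i j _ _; exact: box_of_inj.
apply: eq_bigr => i _; have /andP[g0 gL] := good_box i gg.
rewrite /letter_weight g0 gL /letter_wt -letter_partition_of.
rewrite odd_letter ?partition_of_neq0 //; congr (_ *: fvar _ _).
have := partition_of_neq0 i gg; rewrite /letter_of_int.
case: (partition_of g i) => [k|k] k0 /=; lia.
Qed.

(** [partition_of] is a bijection from the fillings to the enriched P-partitions with absolute
    values at most [N]; the other ones do not reach monomials in the first [N] indeterminates. *)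
Lemma Gamma_filling_sum (K : comNzRingType) (q : K) :
  agree N (Gamma (@skew_lt la mu) q) (filling_sum L muf pos (letter_wt q) L outer_shape).
Proof.
move=> m mN; rewrite /Gamma /fps_sum /= /filling_sum.
rewrite (big_morph (fun f : fps nat K => f m) (fun f g => fcoefD f g m) (erefl _)).
pose r := [seq partition_of g | g <- enum [pred g | good g]].
rewrite (fsbigE r) /=; first last.
- move=> f fE fr; have [k kN] : exists k, (N < `|f k|)%N.
    apply/not_existsP => fN; move/negP: fr; apply.
    have [|g gg <-] := partition_of_surj fE; last by rewrite map_f // mem_enum.
    by move=> k; rewrite leqNgt; apply/negP.
  (* Indeterminates are counted from 0: [N < |f k|] gives one of index at least [N], whose exponent
     in [m] is 0. *)
  rewrite /Gamma_term (bigD1 k) //= -scalerAl fcoefZ mulrC (mulrC (fvar _ _)).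
  by rewrite fcoefMvar mN ?mul0r //; lia.
- by move=> f /= /mapP[g]; rewrite mem_enum => gg ->; exact: partition_of_enriched.
- rewrite map_inj_in_uniq ?enum_uniq // => g g'; rewrite !mem_enum => gg gg'.
  exact: partition_of_inj.
rewrite big_map big_enum_cond /=; apply: eq_big => [g|g /andP[gg _]].
  apply: andb_idr => gg; rewrite inE; exact: partition_of_enriched.
by rewrite Gamma_term_partition_of.
Qed.

End GammaFillings.

(** * Comparison of coefficients *)

Theorem theorem1 (R : realType) (q : R[i]) (la mu : seq nat)
    (sh : skew_shape la mu) :
  HL_S (- q) la mu = Gamma (@skew_lt la mu) q.
Proof.
apply: fpsP => m.
pose N := (\max_(i <- finsupp m) i).+1.
have mN : in_vars N m.
  move=> k; rewrite /N => Nk; apply/eqP; rewrite cmE_eq0; apply: contraL Nk => km.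
  by rewrite -ltnNge ltnS (@leq_bigmax_seq _ _ xpredT id).
rewrite (Gamma_filling_sum sh q mN).
have dec i j : (i <= j)%N -> (nth 0%N mu j <= nth 0%N mu i)%N.
  by apply: part_nth_dec; case/and4P: sh.
rewrite -(JT_filling dec (H := HL_letter q) _ _ _ (leqnn _) (outer_shape_dec sh)).
(* After [N.*2] letters every negative letter is paired with its positive one, so [HL_letter] is the
   product of the first [N] factors. *)
- apply: (agree_det _ mN) => i j; rewrite !mxE (outer_shapeE sh).
  by rewrite /HL_letter doubleK odd_double addr0; exact: agree_HL_q.
- by move=> k; rewrite /HL_letter /= HL_trunc0 addr0.
- move=> k k' k0; rewrite /HL_letter !HL_trunc_neg //; last by lia.
  by case: ifP; rewrite ?mulr0 addr0.
by move=> k k' _; exact: HL_letterS.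
Qed.
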